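(* Let $H=(V,\Delta)$ be a 3-graph with underlying graph $G$. If $H$ has a spanning tree, then for every non-empty $S\subseteq V$ we have $q(G-S)\le |S|-1$, where $q(G-S)$ denotes the number of connected components of $G-S$ having an odd number of vertices.
   Context: A 3-graph is $H=(V,\Delta)$ with $\Delta\subseteq\binom V3$ (triples). The underlying graph $G$ of $H$ is the multigraph on $V$ with an edge $ab$ for each triple containing $\{a,b\}$ (with multiplicity). $G-S$ is $G$ with the vertices of $S$ and incident edges removed. A cycle in $H$ is a sequence $a_0,t_1,a_1,\dots,t_\ell,a_\ell=a_0$, $\ell\ge2$, of distinct vertices $a_0,\dots,a_{\ell-1}$ and distinct triples with $a_{i-1},a_i\in t_i$. A spanning tree is a set of triples containing no cycle, covering $V$, and connected (any two vertices joined by a path of distinct vertices and distinct triples of $T$, consecutive vertices lying in the triple between them). *)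

(* Defs.v *)
From mathcomp Require Import all_boot.

Set Implicit Arguments.
Unset Strict Implicit.
Unset Printing Implicit Defensive.

Record three_graph (V : finType) := ThreeGraph {
  triples :> {set {set V}};
  card_triple : forall t, t \in triples -> #|t| = 3
}.

(* The edges are labels in a finite type E, so that several of them may have
   the same pair of ends; loops are excluded. *)
Record multigraph (V E : finType) := Multigraph {
  vertices : {set V};
  edges : {set E};
  ends : E -> {set V};
  card_ends : forall e, e \in edges -> #|ends e| = 2;
  ends_vertices : forall e, e \in edges -> ends e \subset vertices
}.

Section Multigraph.
Variables (V E : finType) (G : multigraph V E).

Definition adjacent : rel V :=
  fun x y => [exists e in edges G, ends G e == [set x; y]].

Definition components : {set {set V}} :=
  equivalence_partition (connect adjacent) (vertices G).

Definition odd_components_number : nat :=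
  #|[set C in components | odd #|C|]|.

Variable S : {set V}.

Definition remaining_edges : {set E} :=
  [set e in edges G | [disjoint ends G e & S]].

Fact remaining_card_ends e : e \in remaining_edges -> #|ends G e| = 2.
Proof. by rewrite inE => /andP[/card_ends]. Qed.

Fact remaining_ends_vertices e :
  e \in remaining_edges -> ends G e \subset vertices G :\: S.
Proof. by rewrite inE subsetD => /andP[/ends_vertices-> ->]. Qed.

Definition delete_vertices : multigraph V E :=
  Multigraph remaining_card_ends remaining_ends_vertices.

End Multigraph.

Section ThreeGraph.
Variables (V : finType) (H : three_graph V).

(* The label (p, t) is the edge with set of ends p contributed by the
   triple t. *)
Definition underlying_edges : {set {set V} * {set V}} :=
  [set pt : {set V} * {set V} | [&& pt.2 \in H, pt.1 \subset pt.2 & #|pt.1| == 2]].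

Fact underlying_card_ends e : e \in underlying_edges -> #|e.1| = 2.
Proof. by rewrite inE => /and3P[_ _ /eqP]. Qed.

Fact underlying_ends_vertices e :
  e \in underlying_edges -> e.1 \subset [set: V].
Proof. by rewrite subsetT. Qed.

Definition underlying_graph : multigraph V ({set V} * {set V})%type :=
  Multigraph underlying_card_ends underlying_ends_vertices.

End ThreeGraph.

Section SpanningTree.
Variable V : finType.
Implicit Type T : {set {set V}}.

(* Here t i is the triple between a i and its cyclic successor, that is,
   t_(i+1) when triples are numbered from 1. *)
Definition is_cycle T (l : nat) (a : 'I_l -> V) (t : 'I_l -> {set V}) : Prop :=
  [/\ 1 < l, injective a, injective t &
      forall i, [/\ t i \in T, a i \in t i & a (ordS i) \in t i]].

Definition acyclic T : Prop :=
  forall (l : nat) (a : 'I_l -> V) (t : 'I_l -> {set V}), ~ is_cycle T a t.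

(* The two vertices around t i are a i and a i.+1. *)
Definition is_path T (x y : V) (l : nat)
    (a : 'I_l.+1 -> V) (t : 'I_l -> {set V}) : Prop :=
  [/\ a ord0 = x, a ord_max = y, injective a, injective t &
      forall i : 'I_l, [/\ t i \in T,
        a (widen_ord (leqnSn l) i) \in t i & a (lift ord0 i) \in t i]].

Definition connected T : Prop :=
  forall x y : V, exists (l : nat) (a : 'I_l.+1 -> V) (t : 'I_l -> {set V}),
    is_path T x y a t.

Definition is_spanning_tree (H : three_graph V) T : Prop :=
  [/\ T \subset H, acyclic T, cover T = [set: V] & connected T].

End SpanningTree.

(* Main.v *)
Require Import Defs.
From mathcomp Require Import all_boot.

Set Implicit Arguments.
Unset Strict Implicit.
Unset Printing Implicit Defensive.

(** Root a spanning tree at a vertex [r] of [S].  Every triple of the tree has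
    one vertex closest to [r], and its two other vertices form a pair; these
    pairs are edges of the underlying graph and partition the vertices other
    than [r].  An odd component of [G - S] cannot be a union of pairs, so one of
    its vertices is paired with a vertex of [S] other than [r], and different
    components get different vertices of [S]. *)

(** * Parity of sets with a fixed-point-free involution *)

Definition fixfree_involution_on {V : finType} (A : {set V}) (m : V -> V) :=
  forall x, x \in A -> [/\ m x \in A, m x != x & m (m x) = x].

Lemma fixfree_involution_even {V : finType} (m : V -> V) (A : {set V}) :
  fixfree_involution_on A m -> ~~ odd #|A|.
Proof.
have [n] := ubnP #|A|; elim: n A => // n IHn A leAn mA.
have [->|[x xA]] := set_0Vmem A; first by rewrite cards0.
have [mxA mxx mmx] := mA x xA.
have mxAx : m x \in A :\ x by rewrite !inE mxx.
have cardA : #|A| = #|A :\ x :\ m x|.+2.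
  by rewrite (cardsD1 x) xA (cardsD1 (m x) (A :\ x)) mxAx.
rewrite cardA /= negbK; apply: IHn => [|y].
  by move: leAn; rewrite cardA => /ltnW.
(* Removing the orbit of [x] leaves a stable set: a partner of [y] equal to [x] or [m x] would put
   [y] in that orbit. *)
rewrite !inE => /and3P[ymx yx yA]; have [myA myy mmy] := mA y yA.
split=> //; rewrite myA andbT; apply/andP; split; apply: contraNneq yx => E.
  by rewrite -mmy E mmx.
by move: ymx; rewrite -mmy E eqxx.
Qed.

(** * Paths confined to a vertex set *)

Section RootedMatching.
Variables (V : finType) (T : {set {set V}}).
Implicit Types (W : {set V}) (t : {set V}) (m : V -> V).

(* A path is encoded by its first vertex and the list of its subsequent steps,
   a step being a vertex together with the triple leading to it. *)
Definition step : rel (V * {set V}) :=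
  fun p q => [&& q.2 \in T, p.1 \in q.2 & q.1 \in q.2].

(** Confining the triples as well as the vertices to [W] makes any triple not inside [W]
    automatically new to the path. The [set0] is a placeholder: [step] ignores the triple of its
    first argument. *)
Definition path_within W x y := exists s : seq (V * {set V}),
  [/\ path step (x, set0) s, last x (unzip1 s) = y, uniq (x :: unzip1 s),
      uniq (unzip2 s) &
      {subset x :: unzip1 s <= W} /\ forall t, t \in unzip2 s -> t \subset W].

Lemma path_within_sub W W' x y :
  W \subset W' -> path_within W x y -> path_within W' x y.
Proof.
move=> sWW' [s [sp sl us ut [sW tW]]]; exists s; split=> //.
split=> [z /sW|t /tW tWt]; first exact: (subsetP sWW').
exact: subset_trans tWt sWW'.
Qed.

Lemma last_unzip1 (x : V) t (s : seq (V * {set V})) :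
  (last (x, t) s).1 = last x (unzip1 s).
Proof. by rewrite (last_map fst s (x, t)). Qed.

(** As [z] lies outside [W], neither [z] nor [t] can already occur on the path. *)
Lemma path_within_extend W t x y z : t \in T -> y \in t -> z \in t ->
  z \notin W -> path_within W x y -> path_within (W :|: t) x z.
Proof.
move=> tT yt zt zW [s [sp sl us ut [sW tW]]]; exists (rcons s (z, t)).
have tNs : t \notin unzip2 s.
  by apply: contra zW => /tW /subsetP; apply.
split.
- by rewrite rcons_path sp /step /= last_unzip1 sl tT yt zt.
- by rewrite /unzip1 map_rcons last_rcons.
- rewrite /unzip1 map_rcons -rcons_cons rcons_uniq us andbT.
  by apply: contra zW => /sW.
- by rewrite /unzip2 map_rcons rcons_uniq ut tNs.
split=> [w|u].
  rewrite /unzip1 map_rcons -rcons_cons mem_rcons in_cons [w \in _ :|: _]inE.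
  by case/predU1P=> [->|/sW ->] //; rewrite zt orbT.
rewrite /unzip2 map_rcons mem_rcons in_cons => /predU1P[->|/tW uW].
  exact: subsetUr.
by rewrite (subset_trans uW) ?subsetUl.
Qed.

Lemma path_within_prepend W t x y z : t \in T -> x \in t -> z \in t ->
  z \notin W -> path_within W x y -> path_within (W :|: t) z y.
Proof.
move=> tT xt zt zW [s [sp sl us ut [sW tW]]]; exists ((x, t) :: s).
have tNs : t \notin unzip2 s.
  by apply: contra zW => /tW /subsetP; apply.
split.
- rewrite [path _ _ _]/= {1}/step /= tT xt zt /=.
  by case: (s) sp.
- by [].
- by rewrite [unzip1 _]/= cons_uniq us andbT; apply: contra zW => /sW.
- by rewrite /= tNs.
split=> [w|u].
  rewrite [unzip1 _]/= in_cons [w \in _ :|: _]inE.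
  by case/predU1P=> [->|/sW ->] //; rewrite zt orbT.
rewrite [unzip2 _]/= in_cons => /predU1P[->|/tW uW]; first exact: subsetUr.
by rewrite (subset_trans uW) ?subsetUl.
Qed.

(** The triple [t] is not on the path and would close it into a cycle. *)
Lemma path_within_cycle W t x y : acyclic T -> t \in T -> x \in t -> y \in t ->
  x != y -> ~~ (t \subset W) -> ~ path_within W x y.
Proof.
move=> acT tT xt yt xy tW [s [sp sl us ut [sW sTW]]].
have tNs : t \notin unzip2 s by apply: contra tW => /sTW.
(* The cycle has one more triple than the path, [t] being placed last. *)
pose n := (size s).+1.
pose a (i : 'I_n) := nth x (x :: unzip1 s) i.
pose u (i : 'I_n) := nth set0 (rcons (unzip2 s) t) i.
apply: (acT n a u); split.
- by rewrite /n ltnS; case: (s) sl xy => //= ->; rewrite eqxx.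
- move=> i j /eqP; rewrite nth_uniq //= ?size_map ?ltn_ord // => /eqP.
  exact: val_inj.
- move=> i j /eqP; rewrite nth_uniq ?size_rcons ?size_map ?ltn_ord //.
    by move/eqP/val_inj.
  by rewrite rcons_uniq tNs ut.
move=> i; rewrite /a /u nth_rcons size_map.
(* At the last index the successor wraps to 0, and [t] joins [y] back to [x]. *)
have := ltn_ord i; rewrite ltnS leq_eqVlt => /predU1P[Ei|lt_is].
  have -> : nat_of_ord (ordS i) = 0 by rewrite /= Ei modnn.
  rewrite Ei ltnn eqxx tT xt; split=> //.
  by rewrite -(size_map fst s) nth_last /= sl.
have -> : nat_of_ord (ordS i) = i.+1 by rewrite /= modn_small.
have /and3P[h1 h2 h3] := pathP (x, set0) sp i lt_is.
rewrite lt_is /= (nth_map (x, set0)) // (nth_map (x, set0)) //; split=> //.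
by rewrite -[_ :: _]/(unzip1 ((x, set0) :: s)) (nth_map (x, set0)) //= ltnW.
Qed.

(** Along a path from [r], each triple contains a vertex already known to be in [W], so the next
    vertex is in [W] too. *)
Lemma connected_closed W r : connected T -> r \in W ->
  (forall t, t \in T -> t :&: W != set0 -> t \subset W) -> W = setT.
Proof.
move=> cT rW clW; apply/setP=> y; rewrite inE.
have [l [a [t [a0 al _ _ at_]]]] := cT r y.
suff aW k (lt_kl : k < l.+1) : a (Ordinal lt_kl) \in W.
  by rewrite -al -(aW l (ltnSn l)); congr (a _ \in _); apply: val_inj.
elim: k lt_kl => [|k IHk] lt_kl.
  by have -> : Ordinal lt_kl = ord0; [apply: val_inj | rewrite a0].
have [tT at1 at2] := at_ (Ordinal (lt_kl : k < l)).
have Ek : widen_ord (leqnSn l) (Ordinal (lt_kl : k < l)) = Ordinal (ltnW lt_kl).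
  exact: val_inj.
have Ek1 : lift ord0 (Ordinal (lt_kl : k < l)) = Ordinal lt_kl by exact: val_inj.
rewrite Ek in at1; rewrite Ek1 in at2.
apply: (subsetP (clW _ tT _)) at2; apply/set0Pn.
by exists (a (Ordinal (ltnW lt_kl))); rewrite inE at1 IHk.
Qed.

(** * Growing the matching from the root *)

Definition matched_in_triples W m :=
  forall x, x \in W -> exists t, [/\ t \in T, x \in t & m x \in t].

Definition linked W := {in W &, forall x y, path_within W x y}.

Lemma path_within_refl W x : x \in W -> path_within W x x.
Proof.
move=> xW; exists [::]; split=> //; split=> // y.
by rewrite inE => /eqP->.
Qed.

(** Two common vertices would be joined by a path within [W], which [t] would close into a cycle. *)
Lemma acyclic_meet1 W t : acyclic T -> linked W -> t \in T ->
  ~~ (t \subset W) -> #|t :&: W| <= 1.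
Proof.
move=> acT lW tT tW; apply/card_le1_eqP => x y.
rewrite !inE => /andP[xt xW] /andP[yt yW]; apply/eqP/negPn/negP=> xy.
exact: path_within_cycle acT tT yt xt xy tW (lW y x yW xW).
Qed.

Lemma linked_extend W t p : linked W -> t \in T -> p \in W -> p \in t ->
  linked (W :|: t).
Proof.
move=> lW tT pW pt x y xWt yWt.
have memt z : z \in W :|: t -> z \notin W -> z \in t.
  by rewrite inE => /orP[->|].
have [xW|xW] := boolP (x \in W); have [yW|yW] := boolP (y \in W).
- by apply: path_within_sub (lW x y xW yW); apply: subsetUl.
- by apply: (path_within_extend (y := p) tT) (lW x p xW pW) => //; apply: memt.
- by apply: (path_within_prepend (x := p) tT) (lW p y pW yW) => //; apply: memt.
have [<-|xy] := eqVneq x y; first exact: path_within_refl.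
(* Two distinct new vertices are joined by [t] alone, seen as an extension of the trivial path at
   [x]. *)
apply: (path_within_sub (W := [set x] :|: t)).
  by rewrite subUset sub1set xWt subsetUr.
apply: (path_within_extend (y := x) tT) => //; first exact: memt.
- exact: memt.
- by rewrite inE eq_sym.
by apply: path_within_refl; rewrite inE.
Qed.

(** The triple [t] meets [W] in exactly one vertex, so it adds exactly two, which are matched with
    each other. *)
Lemma rooted_matching_grow r W m : acyclic T -> {in T, forall t, #|t| = 3} ->
  r \in W -> linked W ->
  fixfree_involution_on (W :\ r) m -> matched_in_triples (W :\ r) m ->
  forall t, t \in T -> t :&: W != set0 -> ~~ (t \subset W) ->
  exists m', [/\ linked (W :|: t), fixfree_involution_on ((W :|: t) :\ r) m' &
    matched_in_triples ((W :|: t) :\ r) m'].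
Proof.
move=> acT T3 rW lW im mm t tT /set0Pn[p]; rewrite inE => /andP[pt pW] tW.
have card_tW : #|t :&: W| = 1.
  apply/eqP; rewrite eqn_leq acyclic_meet1 //=.
  by apply/card_gt0P; exists p; rewrite inE pt.
have : #|t :\: W| == 2 by rewrite cardsD T3 // card_tW.
case/cards2P=> x [y [xy Et]].
have memt z : (z \notin W) && (z \in t) = (z == x) || (z == y).
  by rewrite -in_set2 -Et inE.
have /andP[xW xt] : (x \notin W) && (x \in t) by rewrite memt eqxx.
have /andP[yW yt] : (y \notin W) && (y \in t) by rewrite memt eqxx orbT.
have neW z w : z \in W -> w \notin W -> (z == w) = false.
  by move=> zW wW; apply: contraNF wW => /eqP<-.
have Wt z : z \in (W :|: t) :\ r -> [\/ z \in W :\ r, z = x | z = y].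
  rewrite !inE; case: (boolP (z \in W)) => [zW /= /andP[-> _]|zW /= /andP[_ zt]].
    by constructor 1.
  have := memt z; rewrite zW zt => /esym/orP[]/eqP->; first by constructor 2.
  by constructor 3.
pose m' z := if z == x then y else if z == y then x else m z.
have m'x : m' x = y by rewrite /m' eqxx.
have m'y : m' y = x by rewrite /m' eqxx eq_sym (negbTE xy).
have m'W z : z \in W -> m' z = m z by move=> zW; rewrite /m' !neW.
exists m'; split; first exact: linked_extend pt.
- move=> z /Wt[zW|->|->].
  + have [mzW mzz mmz] := im z zW.
    have [_ zW'] := setD1P zW; have [mzr mzW'] := setD1P mzW.
    by rewrite !m'W // !inE mzr mzW'.
  + by rewrite m'x m'y eq_sym xy !inE yt orbT andbT eq_sym neW.
  + by rewrite m'y m'x xy !inE xt orbT andbT eq_sym neW.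
move=> z /Wt[zW|->|->].
- by have [_ zW'] := setD1P zW; rewrite m'W //; apply: mm.
- by exists t; rewrite m'x.
- by exists t; rewrite m'y.
Qed.

(** Starting from [[set r]], where the matching is vacuous, triples are absorbed until none
    straddles [W]; connectedness then forces [W = setT]. The induction is on the size of the
    complement of [W]. *)
Lemma rooted_matching r : acyclic T -> {in T, forall t, #|t| = 3} ->
  connected T ->
  exists m, fixfree_involution_on [set~ r] m /\ matched_in_triples [set~ r] m.
Proof.
move=> acT T3 cT; rewrite -setTD.
suff grow n W m : #|~: W| < n -> r \in W -> linked W ->
    fixfree_involution_on (W :\ r) m -> matched_in_triples (W :\ r) m ->
    exists m', fixfree_involution_on (setT :\ r) m' /\
               matched_in_triples (setT :\ r) m'.
  apply: (grow _ [set r] id (ltnSn _)); rewrite ?set11 ?setDv //.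
  - by move=> x y /set1P-> /set1P->; apply/path_within_refl/set11.
  - by move=> x; rewrite inE.
  - by move=> x; rewrite inE.
elim: n W m => // n IHn W m ltWn rW lW im mm.
have [t /and3P[tT tW0 tW]|closedW] := pickP
    [pred t | [&& t \in T, t :&: W != set0 & ~~ (t \subset W)]].
  have [m' [lW' im' mm']] := rooted_matching_grow acT T3 rW lW im mm tT tW0 tW.
  have rWt : r \in W :|: t by rewrite inE rW.
  apply: (IHn _ m') rWt lW' im' mm'; apply: leq_trans (_ : #|~: W| <= n) => //.
  by rewrite proper_card // /proper !setCS subsetUl subUset subxx.
have EW : W = setT.
  apply: (connected_closed cT rW) => t tT tW0.
  by have := closedW t; rewrite /= tT tW0 => /negbFE.
by exists m; rewrite -EW.
Qed.

End RootedMatching.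

(** * Components and adjacency after deleting vertices *)

Lemma adjacent_sym (V E : finType) (G : multigraph V E) : symmetric (adjacent G).
Proof. by move=> x y; rewrite /adjacent setUC. Qed.

Lemma connect_adjacent_equiv (V E : finType) (G : multigraph V E) :
  equivalence_rel (connect (adjacent G)).
Proof.
apply/equivalence_relP; split=> // x.
exact/same_connect/sym_connect_sym/adjacent_sym.
Qed.

Lemma components_partition (V E : finType) (G : multigraph V E) :
  partition (components G) (vertices G).
Proof.
by apply: equivalence_partitionP => x y z _ _ _; apply: connect_adjacent_equiv.
Qed.

Lemma adjacent_pblock (V E : finType) (G : multigraph V E) x y :
  x \in vertices G -> y \in vertices G -> adjacent G x y ->
  y \in pblock (components G) x.
Proof.
move=> xG yG xy; rewrite pblock_equivalence_partition ?connect1 //.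
by move=> u v w _ _ _; apply: connect_adjacent_equiv.
Qed.

Lemma underlying_adjacent (V : finType) (H : three_graph V) (S t : {set V}) x y :
  t \in triples H -> x \in t -> y \in t -> x != y -> x \notin S -> y \notin S ->
  adjacent (delete_vertices (underlying_graph H) S) x y.
Proof.
move=> tH xt yt xy xS yS; apply/existsP; exists ([set x; y], t) => /=.
rewrite eqxx andbT !inE /= tH cards2 xy subUset !sub1set xt yt /=.
by rewrite disjoints_subset subUset !sub1set !inE xS.
Qed.

Theorem theorem3p5 (V : finType) (H : three_graph V)
  (hT : exists T : {set {set V}}, is_spanning_tree H T)
  (S : {set V}) (hS : S != set0) :
  odd_components_number (delete_vertices (underlying_graph H) S) <= #|S| - 1.
Proof.
case: hT => T [sTH acT _ cT]; have [r rS] := set0Pn _ hS.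
have T3 : {in T, forall t : {set V}, #|t| = 3}.
  by move=> t /(subsetP sTH); apply: card_triple.
have [m [im mm]] := rooted_matching r acT T3 cT.
set G := delete_vertices _ S; pose P := components G.
have partP : partition P (vertices G) := components_partition G.
have tiP := partition_trivIset partP.
have memG x : (x \in vertices G) = (x \notin S) by rewrite /= !inE andbT.
have -> : #|S| - 1 = #|S :\ r| by rewrite (cardsD1 r S) rS add1n subn1.
rewrite /odd_components_number.
(* It suffices that every odd component is the block of [m z] for some [z] in [S :\ r]. *)
apply: leq_trans (leq_imset_card (fun z => pblock P (m z)) (S :\ r)).
apply/subset_leq_card/subsetP=> C; rewrite inE => /andP[CP oddC].
have CG : C \subset vertices G by rewrite -(cover_partition partP); apply: bigcup_sup.
have CS x : x \in C -> x \notin S by move/(subsetP CG); rewrite memG.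
have Cr x : x \in C -> x \in [set~ r].
  by move=> /CS xS; rewrite !inE; apply: contraNneq xS => ->.
(* Otherwise [m] would act on [C] without fixed points, making its size even. *)
have [x xC mxC] : exists2 x, x \in C & m x \notin C.
  apply/exists_inP; apply: contraLR oddC => /exists_inPn CmC.
  apply: (@fixfree_involution_even _ m) => x xC.
  by have [_ mxx mmx] := im x (Cr x xC); split=> //; have := CmC x xC; rewrite negbK.
have [mxr mxx mmx] := im x (Cr x xC); have xS := CS x xC.
have defC : pblock P x = C := def_pblock tiP CP xC.
apply/imsetP; exists (m x); last by rewrite mmx defC.
rewrite inE; move: mxr; rewrite !inE => -> /=.
(* Were [m x] outside [S], the edge from [x] to [m x] would survive the deletion and keep [m x] in
   [C]. *)
apply: contraR mxC => mxS; have [t [tT xt mxt]] := mm x (Cr x xC).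
rewrite -defC; apply: adjacent_pblock; rewrite ?memG //.
apply: (underlying_adjacent (subsetP sTH t tT) xt mxt) => //.
by rewrite eq_sym.
Qed.
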